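(* Let $S$ be a restriction semigroup. Let $\widehat{F}_s,\widetilde{F}_s$ be the restrictions of the functors $\widehat{F},\widetilde{F}$ to the category $\mathcal{A}_s(S)$, and let $\widehat{I}_s\colon\widehat{\mathcal{A}}_s(S)\to\mathcal{A}_s(S)$, $\widetilde{I}_s\colon\widetilde{\mathcal{A}}_s(S)\to\mathcal{A}_s(S)$ be the inclusion functors. Then: (1) the functor $\widehat{F}_s\colon\mathcal{A}_s(S)\to\widehat{\mathcal{A}}_s(S)$ is a left adjoint to $\widehat{I}_s$; (2) the functor $\widetilde{F}_s\colon\mathcal{A}_s(S)\to\widetilde{\mathcal{A}}_s(S)$ is a right adjoint to $\widetilde{I}_s$; (3) the functors $\widetilde{F}_s\widehat{I}_s\colon\widehat{\mathcal{A}}_s(S)\to\widetilde{\mathcal{A}}_s(S)$ and $\widehat{F}_s\widetilde{I}_s\colon\widetilde{\mathcal{A}}_s(S)\to\widehat{\mathcal{A}}_s(S)$ establish an isomorphism between the categories $\widehat{\mathcal{A}}_s(S)$ and $\widetilde{\mathcal{A}}_s(S)$.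
   Context: A restriction semigroup is an algebra $(S;\cdot,{}^*,{}^+)$ of type $(2,1,1)$ such that $(S;\cdot)$ is a semigroup and the following identities hold: $x^+x=x$, $x^+y^+=y^+x^+$, $(x^+y)^+=x^+y^+$, $(xy)^+x=xy^+$; $xx^*=x$, $x^*y^*=y^*x^*$, $(xy^* )^*=x^*y^*$, $y(xy)^*=x^*y$; $(x^+)^*=x^+$, $(x^* )^+=x^*$. $P(S)=\{s^*\colon s\in S\}=\{s^+\colon s\in S\}$ is the semilattice of projections. The natural partial order is: $s\le t$ iff $s=et$ for some $e\in P(S)$. Inverse semigroups are restriction semigroups via $s^*=s^{-1}s$, $s^+=ss^{-1}$. $\mathcal{I}(X)$ is the symmetric inverse semigroup of all partial bijections of $X$, composed from right to left. For a subset $B$ of a poset, $B^\downarrow$ is the set of elements lying below some element of $B$, and $b^\downarrow=\{b\}^\downarrow$. A premorphism $\varphi\colon S\to T$ between restriction semigroups is a map with $\varphi(s)\varphi(t)\le\varphi(st)$, $\varphi(s)^*\le\varphi(s^* )$ and $\varphi(s)^+\le\varphi(s^+)$ for all $s,t\in S$. For $T=\mathcal{I}(X)$ we write $\varphi_s$ for $\varphi(s)$. The category $\mathcal{A}(S)$: objects are triples $(\alpha,p,X)$ where $X$ is a semilattice, $p\colon X\to P(S)$ is a semilattice morphism and $\alpha\colon S\to\mathcal{I}(X)$ is a premorphism such that: (A1) for all $s\in S$, $\operatorname{dom}\alpha_s$ and $\operatorname{ran}\alpha_s$ are order ideals of $X$; (A2) for all $s\in S$, $\alpha_s$ is an order isomorphism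 (from its domain onto its range); (A3) for all $e\in P(S)$, $(p^{-1}(e))^\downarrow\subseteq\operatorname{dom}\alpha_e\subseteq p^{-1}(e^\downarrow)$; (A4) for all $s\in S$, $\operatorname{dom}\alpha_s\cap p^{-1}(s^* )\ne\varnothing$. A morphism from $(\alpha,p_\alpha,X)$ to $(\beta,p_\beta,Y)$ is a semilattice morphism $f\colon X\to Y$ such that (M1) $p_\alpha=p_\beta f$; (M2) $f(\operatorname{dom}\alpha_s)\subseteq\operatorname{dom}\beta_s$ and $\beta_s(f(e))=f(\alpha_s(e))$ for all $s\in S$ and $e\in\operatorname{dom}\alpha_s$. $\widehat{\mathcal{A}}(S)$ is the full subcategory of $\mathcal{A}(S)$ whose objects satisfy (A3a): for all $s\in S$, $\operatorname{dom}\alpha_s=\{y\in X\colon y\in\operatorname{dom}\alpha_t\cap p^{-1}(t^* )\text{ for some }t\le s\}$. $\widetilde{\mathcal{A}}(S)$ is the full subcategory whose objects satisfy (A3b): for all $s\in S$, $\operatorname{dom}\alpha_s=(\operatorname{dom}\alpha_s\cap p^{-1}(s^* ))^\downarrow$. $\mathcal{A}_s(S)$, $\widehat{\mathcal{A}}_s(S)$, $\widetilde{\mathcal{A}}_s(S)$ are the subcategories of $\mathcal{A}(S)$, $\widehat{\mathcal{A}}(S)$, $\widetilde{\mathcal{A}}(S)$, respectively, with the same objects, whose morphisms $f$ from $(\alpha,p_\alpha,X)$ to $(\beta,p_\beta,Y)$ satisfy in addition (M3): $\operatorname{dom}\beta_s\cap p_\beta^{-1}(s^* )=f(\operatorname{dom}\alpha_s\cap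 p_\alpha^{-1}(s^* ))$ for all $s\in S$. (The subscript $s$ in the names of these categories and functors is just part of the notation and is unrelated to elements of $S$.) The functor $\widehat F\colon\mathcal{A}(S)\to\widehat{\mathcal{A}}(S)$ sends an object $(\varphi,p,X)$ to $(\widehat\varphi,p,X)$, where $\operatorname{dom}\widehat\varphi_s=\{x\in X\colon x\in\operatorname{dom}\varphi_t\text{ for some }t\le s\}$ and $\widehat\varphi_s(x)=\varphi_t(x)$ for any $t\le s$ with $x\in\operatorname{dom}\varphi_t$. The functor $\widetilde F\colon\mathcal{A}(S)\to\widetilde{\mathcal{A}}(S)$ sends $(\varphi,p,X)$ to $(\widetilde\varphi,p,X)$, where $\widetilde\varphi_s$ is the restriction of $\varphi_s$ to $\{x\in\operatorname{dom}\varphi_s\colon p(x)=s^*\}^\downarrow$. Both functors leave the underlying semilattice maps of morphisms unchanged. *)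

(* Defs.v *)
From HB Require Import structures.
From mathcomp Require Import all_boot.
From mathcomp Require Import boolp classical_sets.
Set Implicit Arguments.
Unset Strict Implicit.
Unset Printing Implicit Defensive.

Local Open Scope classical_set_scope.
Local Open Scope group_scope.

(* [semigroupType] of the library bundles a choice operator with the carrier;
   the structures below are built on [magmaType], which does not. *)
HB.mixin Record Magma_isAssociative G of Magma G := {
  mulgAssoc : associative (@mul G)
}.

HB.structure Definition AssocMagma := {G of Magma G & Magma_isAssociative G}.

HB.mixin Record AssocMagma_isRestriction S of AssocMagma S := {
  star : S -> S;
  plus : S -> S;
  plus_mull : forall x : S, plus x * x = x;
  plusC : forall x y : S, plus x * plus y = plus y * plus x;
  plusMl : forall x y : S, plus (plus x * y) = plus x * plus y;
  plus_ample : forall x y : S, plus (x * y) * x = x * plus y;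
  star_mulr : forall x : S, x * star x = x;
  starC : forall x y : S, star x * star y = star y * star x;
  starMr : forall x y : S, star (x * star y) = star x * star y;
  star_ample : forall x y : S, y * star (x * y) = star x * y;
  plusK : forall x : S, star (plus x) = plus x;
  starK : forall x : S, plus (star x) = star x
}.

#[short(type="restrictionSemigroupType")]
HB.structure Definition RestrictionSemigroup :=
  {S of AssocMagma S & AssocMagma_isRestriction S}.

(* Commutative idempotent semigroups; the meet is written [x * y]. *)
HB.mixin Record AssocMagma_isSemilattice X of AssocMagma X := {
  meetC : commutative (@mul X);
  meetI : idempotent_op (@mul X)
}.

#[short(type="semilatticeType")]
HB.structure Definition Semilattice :=
  {X of AssocMagma X & AssocMagma_isSemilattice X}.

Definition sle (X : semilatticeType) (x y : X) : Prop := x * y = x.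

Definition downset (X : semilatticeType) (B : set X) : set X :=
  [set x | exists2 b, B b & sle x b].

Definition order_ideal (X : semilatticeType) (B : set X) : Prop :=
  forall x y, B y -> sle x y -> B x.

Section SemilatticeTheory.
Variable X : semilatticeType.
Implicit Types x y z : X.

Lemma sle_refl x : sle x x.
Proof. exact: meetI. Qed.

Lemma sle_trans y x z : sle x y -> sle y z -> sle x z.
Proof. by rewrite /sle => xy yz; rewrite -xy -mulgAssoc yz. Qed.

Lemma sle_anti x y : sle x y -> sle y x -> x = y.
Proof. by rewrite /sle => xy yx; rewrite -xy meetC yx. Qed.

Lemma sle_meetl x y : sle (x * y) x.
Proof. by rewrite /sle meetC mulgAssoc meetI. Qed.

Lemma sle_meetr x y : sle (x * y) y.
Proof. by rewrite /sle -mulgAssoc meetI. Qed.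

Lemma sle_meet x y z : sle z x -> sle z y -> sle z (x * y).
Proof. by rewrite /sle => zx zy; rewrite mulgAssoc zx. Qed.

Lemma downset_ideal (B : set X) : order_ideal (downset B).
Proof. by move=> x y [b Bb yb] xy; exists b => //; exact: sle_trans yb. Qed.

End SemilatticeTheory.

Lemma sle_morph (X Y : semilatticeType) (f : {multiplicative X -> Y}) x y :
  sle x y -> sle (f x) (f y).
Proof. by rewrite /sle => xy; rewrite -gmulfM xy. Qed.

Record proj (S : restrictionSemigroupType) : Type := Proj {
  proj_val :> S;
  projP : exists s, star s = proj_val
}.

Section RestrictionTheory.
Variable S : restrictionSemigroupType.
Implicit Types (s t u x y : S) (e f : proj S).

Lemma proj_inj e f : e = f :> S -> e = f.
Proof.
case: e f => [e Pe] [f Pf] /= ef; case: _ / ef Pf => Pf.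
by congr Proj; exact: Prop_irrelevance.
Qed.

Definition proj_star s : proj S := Proj (ex_intro _ s erefl).

Lemma proj_plus_subproof s : exists t, star t = plus s.
Proof. by exists (plus s); rewrite plusK. Qed.

Definition proj_plus s : proj S := Proj (proj_plus_subproof s).

Lemma starst s : star (star s) = star s.
Proof. by have := plusK (star s); rewrite starK. Qed.

Lemma star_proj e : star e = e :> S.
Proof. by case: e => e [s es] /=; rewrite -es starst. Qed.

Lemma plus_proj e : plus e = e :> S.
Proof. by rewrite -star_proj starK. Qed.

Lemma proj_starE e : proj_star e = e.
Proof. by apply: proj_inj; rewrite /= star_proj. Qed.

Lemma proj_mul_subproof e f : exists s, star s = (e : S) * (f : S).
Proof. by exists ((e : S) * (f : S)); rewrite -[in LHS](star_proj f) starMr !star_proj. Qed.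

Definition proj_mul e f : proj S := Proj (proj_mul_subproof e f).

HB.instance Definition _ := hasMul.Build (proj S) proj_mul.

Lemma proj_mulA : associative (@mul (proj S)).
Proof. by move=> e f g; apply: proj_inj; rewrite /= mulgAssoc. Qed.

HB.instance Definition _ := Magma_isAssociative.Build (proj S) proj_mulA.

Lemma proj_mulC : commutative (@mul (proj S)).
Proof.
by move=> e f; apply: proj_inj; rewrite /= -(star_proj e) -(star_proj f) starC.
Qed.

Lemma proj_mulI : idempotent_op (@mul (proj S)).
Proof.
by move=> e; apply: proj_inj; rewrite /= -[X in _ * X]star_proj star_mulr.
Qed.

HB.instance Definition _ :=
  AssocMagma_isSemilattice.Build (proj S) proj_mulC proj_mulI.

Lemma proj_valM e f : (e * f : proj S) = (e : S) * (f : S) :> S.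
Proof. by []. Qed.

Definition rle s t : Prop := exists e : proj S, s = (e : S) * t.

Lemma rle_refl s : rle s s.
Proof. by exists (proj_plus s); rewrite /= plus_mull. Qed.

Lemma rle_trans t s u : rle s t -> rle t u -> rle s u.
Proof. by move=> [e ->] [f ->]; exists (e * f); rewrite proj_valM mulgAssoc. Qed.

Lemma rle_star s t : rle s t -> s = t * star s.
Proof. by move=> [e ->]; rewrite star_ample star_proj. Qed.

Lemma rle_plus s t : rle s t -> s = plus s * t.
Proof.
move=> [e ->]; rewrite -[in RHS](plus_proj e) plusMl plus_proj.
by rewrite -mulgAssoc plus_mull.
Qed.

Lemma rle_mulr s e : rle (s * (e : S)) s.
Proof. by exists (proj_plus (s * (e : S))); rewrite /= plus_ample plus_proj. Qed.

Lemma rle_mul s s' t t' : rle s' s -> rle t' t -> rle (s' * t') (s * t).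
Proof.
move=> [e ->] tt'; rewrite (rle_star tt').
apply: (@rle_trans (s * t * star t')); last exact: (rle_mulr _ (proj_star t')).
by exists e; rewrite !mulgAssoc.
Qed.

Lemma sle_star s t : rle s t -> sle (proj_star s) (proj_star t).
Proof.
move=> st; apply: proj_inj; rewrite proj_valM /=.
by rewrite [in RHS](rle_star st) starMr starC.
Qed.

Lemma rle_star2 s t : rle s t -> rle (star s) (star t).
Proof. by move/sle_star => st; exists (proj_star s); exact: (congr1 (@proj_val S) (esym st)). Qed.

Lemma sle_plus s t : rle s t -> sle (proj_plus s) (proj_plus t).
Proof.
move=> st; apply: proj_inj; rewrite proj_valM /=.
by rewrite [in RHS](rle_plus st) plusMl.
Qed.

Lemma rle_plus2 s t : rle s t -> rle (plus s) (plus t).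
Proof. by move/sle_plus => st; exists (proj_plus s); exact: (congr1 (@proj_val S) (esym st)). Qed.

Lemma rle_proj s e : rle s e -> exists2 f : proj S, s = f & sle f e.
Proof. by move=> [f ->]; exists (f * e) => //; exact: sle_meetr. Qed.

Lemma rle_star_eq s t : rle s t -> proj_star s = proj_star t -> s = t.
Proof.
move=> st ss; rewrite (rle_star st) -[star s]/(proj_star s : S) ss /=.
exact: star_mulr.
Qed.

Lemma star_mul_star s t : star (star s * t) = star (s * t).
Proof.
rewrite -star_ample starMr starC -starMr -mulgAssoc.
by rewrite star_mulr.
Qed.

End RestrictionTheory.

Definition premorphism (S T : restrictionSemigroupType) (phi : S -> T) : Prop :=
  [/\ forall s t, rle (phi s * phi t) (phi (s * t)),
      forall s, rle (star (phi s)) (phi (star s)) &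
      forall s, rle (plus (phi s)) (phi (plus s))].

(* A partial bijection is given by its graph: [f x y] means that [f] is defined
   at [x] with value [y]. *)
Record pbij (X : Type) : Type := PBij {
  pgraph :> X -> X -> Prop;
  pbij_fun : forall x y y', pgraph x y -> pgraph x y' -> y = y';
  pbij_inj : forall x x' y, pgraph x y -> pgraph x' y -> x = x'
}.

Section PBij.
Variable X : Type.
Implicit Types f g h : pbij X.

Definition dom f : set X := [set x | exists y, f x y].
Definition ran f : set X := [set y | exists x, f x y].

Lemma pbij_ext f g : (forall x y, f x y <-> g x y) -> f = g.
Proof.
case: f g => [f f1 f2] [g g1 g2] /= fg.
have E : f = g by apply/funext => x; apply/funext => y; apply/propext.
by case: _ / E g1 g2 fg => *; congr PBij; exact: Prop_irrelevance.
Qed.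

Definition pbij_inv f : pbij X :=
  PBij (fun y x x' => @pbij_inj X f x x' y) (fun y y' x => @pbij_fun X f x y y').

Lemma pbij_comp_fun f g x y y' :
  (exists2 z, g x z & f z y) -> (exists2 z, g x z & f z y') -> y = y'.
Proof.
move=> [z xz zy] [z' xz' zy']; have E := pbij_fun xz xz'; subst z'.
exact: pbij_fun zy zy'.
Qed.

Lemma pbij_comp_inj f g x x' y :
  (exists2 z, g x z & f z y) -> (exists2 z, g x' z & f z y) -> x = x'.
Proof.
move=> [z xz zy] [z' xz' zy']; have E := pbij_inj zy zy'; subst z'.
exact: pbij_inj xz xz'.
Qed.

(* Right-to-left composition: first [g], then [f]. *)
Definition pbij_comp f g : pbij X :=
  PBij (@pbij_comp_fun f g) (@pbij_comp_inj f g).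

HB.instance Definition _ := hasMul.Build (pbij X) pbij_comp.

Lemma pbij_mulA : associative (@mul (pbij X)).
Proof.
move=> f g h; apply: pbij_ext => x y; split.
- by move=> [z [w xw wz] zy]; exists w => //; exists z.
- by move=> [w xw [z wz zy]]; exists z => //; exists w.
Qed.

HB.instance Definition _ := Magma_isAssociative.Build (pbij X) pbij_mulA.

Definition pbij_star f : pbij X := pbij_inv f * f.
Definition pbij_plus f : pbij X := f * pbij_inv f.

Lemma pbij_starE f x y : pbij_star f x y <-> x = y /\ dom f x.
Proof.
split; first by move=> [z xz yz]; split; [exact: (@pbij_inj _ f _ _ z) | exists z].
by move=> [<- [z xz]]; exists z.
Qed.

Lemma pbij_plusE f x y : pbij_plus f x y <-> x = y /\ ran f x.
Proof.
split; first by move=> [z xz yz]; split; [exact: (@pbij_fun _ f z) | exists z].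
by move=> [<- [z xz]]; exists z.
Qed.

Lemma pbij_plus_mull f : pbij_plus f * f = f.
Proof.
apply: pbij_ext => x y; split; first by move=> [z xz /pbij_plusE[<-]].
by move=> xy; exists y => //; apply/pbij_plusE; split => //; exists x.
Qed.

Lemma pbij_plusC f g : pbij_plus f * pbij_plus g = pbij_plus g * pbij_plus f.
Proof.
apply: pbij_ext => x y; split => -[z /pbij_plusE[<- ?] /pbij_plusE[<- ?]];
  by exists x; apply/pbij_plusE.
Qed.

Lemma pbij_plusMl f g : pbij_plus (pbij_plus f * g) = pbij_plus f * pbij_plus g.
Proof.
apply: pbij_ext => x y; split.
- move=> /pbij_plusE[<- [w [z wz /pbij_plusE[zx rz]]]]; subst z.
  by exists x; apply/pbij_plusE; split => //; exists w.
- move=> [z /pbij_plusE[<- [w wx]] /pbij_plusE[<- rx]].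
  by apply/pbij_plusE; split => //; exists w; exists x => //; apply/pbij_plusE.
Qed.

Lemma pbij_plus_ample f g : pbij_plus (f * g) * f = f * pbij_plus g.
Proof.
apply: pbij_ext => x y; split.
- move=> [z xz /pbij_plusE[<- [w [v wv vz]]]].
  have E := pbij_inj xz vz; subst v.
  by exists x => //; apply/pbij_plusE; split => //; exists w.
- move=> [z /pbij_plusE[<- [w wx]] xy]; exists y => //.
  by apply/pbij_plusE; split => //; exists w; exists x.
Qed.

Lemma pbij_star_mulr f : f * pbij_star f = f.
Proof.
apply: pbij_ext => x y; split; first by move=> [z /pbij_starE[<-]].
by move=> xy; exists x => //; apply/pbij_starE; split => //; exists y.
Qed.

Lemma pbij_starC f g : pbij_star f * pbij_star g = pbij_star g * pbij_star f.
Proof.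
apply: pbij_ext => x y; split => -[z /pbij_starE[<- ?] /pbij_starE[<- ?]];
  by exists x; apply/pbij_starE.
Qed.

Lemma pbij_starMr f g : pbij_star (f * pbij_star g) = pbij_star f * pbij_star g.
Proof.
apply: pbij_ext => x y; split.
- move=> /pbij_starE[<- [w [z /pbij_starE[<- dx] xw]]].
  by exists x; apply/pbij_starE; split => //; exists w.
- move=> [z /pbij_starE[<- dx] /pbij_starE[<- [w xw]]].
  by apply/pbij_starE; split => //; exists w; exists x => //; apply/pbij_starE.
Qed.

Lemma pbij_star_ample f g : g * pbij_star (f * g) = pbij_star f * g.
Proof.
apply: pbij_ext => x y; split.
- move=> [z /pbij_starE[<- [w [v xv vw]]] xy].
  exists y => //; apply/pbij_starE; split => //.
  by rewrite (pbij_fun xy xv); exists w.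
- move=> [z xz /pbij_starE[<- [w zw]]]; exists x => //.
  by apply/pbij_starE; split => //; exists w; exists z.
Qed.

Lemma pbij_plusK f : pbij_star (pbij_plus f) = pbij_plus f.
Proof.
apply: pbij_ext => x y; split.
- by move=> /pbij_starE[<- [z /pbij_plusE[_ rx]]]; apply/pbij_plusE.
- move=> /pbij_plusE[<- rx]; apply/pbij_starE; split => //.
  by exists x; apply/pbij_plusE.
Qed.

Lemma pbij_starK f : pbij_plus (pbij_star f) = pbij_star f.
Proof.
apply: pbij_ext => x y; split.
- by move=> /pbij_plusE[<- [z /pbij_starE[-> dx]]]; apply/pbij_starE.
- move=> /pbij_starE[<- rx]; apply/pbij_plusE; split => //.
  by exists x; apply/pbij_starE.
Qed.

HB.instance Definition _ := AssocMagma_isRestriction.Build (pbij X)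
  pbij_plus_mull pbij_plusC pbij_plusMl pbij_plus_ample
  pbij_star_mulr pbij_starC pbij_starMr pbij_star_ample pbij_plusK pbij_starK.

Lemma pbij_leP f g : rle f g <-> forall x y, f x y -> g x y.
Proof.
split=> [/rle_star -> x y [z /pbij_starE[<- _]] // | fg].
exists (proj_plus f); apply: pbij_ext => x y; split.
- move=> xy; exists y; first exact: fg.
  by apply/pbij_plusE; split => //; exists x.
- by move=> [z xz /pbij_plusE[<- [w wz]]]; rewrite (pbij_inj xz (fg _ _ wz)).
Qed.

End PBij.

Section PremorphismTheory.
Variables (S : restrictionSemigroupType) (X : Type) (phi : S -> pbij X).

Lemma premorphismP : premorphism phi <->
  [/\ forall s t x y z, phi t x y -> phi s y z -> phi (s * t) x z,
      forall s x, dom (phi s) x -> phi (star s) x x &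
      forall s y, ran (phi s) y -> phi (plus s) y y].
Proof.
split=> -[pM pS pP]; split.
- by move=> s t x y z xy yz; move/pbij_leP: (pM s t); apply; exists y.
- by move=> s x dx; move/pbij_leP: (pS s); apply; apply/pbij_starE.
- by move=> s x dx; move/pbij_leP: (pP s); apply; apply/pbij_plusE.
- by move=> s t; apply/pbij_leP => x z [y xy yz]; exact: pM yz.
- by move=> s; apply/pbij_leP => x y /pbij_starE[<-]; exact: pS.
- by move=> s; apply/pbij_leP => x y /pbij_plusE[<-]; exact: pP.
Qed.

Hypothesis phiP : premorphism phi.

Lemma preM s t x y z : phi t x y -> phi s y z -> phi (s * t) x z.
Proof. by case/premorphismP: phiP => + _ _; apply. Qed.

Lemma pre_star s x y : phi s x y -> phi (star s) x x.
Proof. by move=> xy; case/premorphismP: phiP => _ + _; apply; exists y. Qed.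

Lemma pre_plus s x y : phi s x y -> phi (plus s) y y.
Proof. by move=> xy; case/premorphismP: phiP => _ _; apply; exists x. Qed.

Lemma pre_compat_fun s t u x y z :
  rle t s -> rle u s -> phi t x y -> phi u x z -> y = z.
Proof.
move=> ts us xy xz.
have tu : t * star u = u * star t.
  transitivity (s * (star t * star u)); first by rewrite mulgAssoc -(rle_star ts).
  by rewrite starC mulgAssoc -(rle_star us).
apply: (@pbij_fun _ (phi (t * star u)) x).
- exact: preM (pre_star xz) xy.
- by rewrite tu; exact: preM (pre_star xy) xz.
Qed.

Lemma pre_compat_inj s t u x y z :
  rle t s -> rle u s -> phi t x z -> phi u y z -> x = y.
Proof.
move=> ts us xz yz.
have tu : plus u * t = plus t * u.
  transitivity (plus u * plus t * s); first by rewrite -mulgAssoc -(rle_plus ts).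
  by rewrite plusC -mulgAssoc -(rle_plus us).
apply: (@pbij_inj _ (phi (plus u * t)) _ _ z).
- exact: preM xz (pre_plus yz).
- by rewrite tu; exact: preM yz (pre_plus xz).
Qed.

End PremorphismTheory.

Record category := Category {
  obj :> Type;
  hom : obj -> obj -> Type;
  cid : forall a, hom a a;
  ccomp : forall a b c, hom b c -> hom a b -> hom a c;
  ccompA : forall a b c d (h : hom c d) (g : hom b c) (f : hom a b),
    ccomp h (ccomp g f) = ccomp (ccomp h g) f;
  ccomp1l : forall a b (f : hom a b), ccomp (cid b) f = f;
  ccomp1r : forall a b (f : hom a b), ccomp f (cid a) = f
}.

Record functor (C D : category) := Functor {
  fobj :> C -> D;
  fmap : forall a b : C, hom a b -> hom (fobj a) (fobj b);
  fmap1 : forall a : C, fmap (cid a) = cid (fobj a);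
  fmapM : forall (a b c : C) (g : hom b c) (f : hom a b),
    fmap (ccomp g f) = ccomp (fmap g) (fmap f)
}.
Arguments fmap {C D} F {a b} f : rename.

Definition functor_id (C : category) : functor C C :=
  @Functor C C id (fun _ _ f => f) (fun=> erefl) (fun _ _ _ _ _ => erefl).

Section FunctorComp.
Variables (C D E : category) (G : functor D E) (F : functor C D).

Lemma functor_comp1 (a : C) : fmap G (fmap F (cid a)) = cid (G (F a)).
Proof. by rewrite !fmap1. Qed.

Lemma functor_compM (a b c : C) (g : hom b c) (f : hom a b) :
  fmap G (fmap F (ccomp g f)) = ccomp (fmap G (fmap F g)) (fmap G (fmap F f)).
Proof. by rewrite !fmapM. Qed.

Definition functor_comp : functor C E :=
  @Functor C E (fun a => G (F a)) (fun _ _ f => fmap G (fmap F f))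
    functor_comp1 functor_compM.

End FunctorComp.

Definition left_adjoint (C D : category) (F : functor C D) (G : functor D C) : Prop :=
  exists phi : forall (c : C) (d : D), hom (F c) d -> hom c (G d),
    (forall c d, bijective (phi c d)) /\
    (forall (c c' : C) (d d' : D) (f : hom c' c) (g : hom d d') (h : hom (F c) d),
       phi c' d' (ccomp g (ccomp h (fmap F f))) =
       ccomp (fmap G g) (ccomp (phi c d h) f)).

Definition right_adjoint (C D : category) (G : functor D C) (F : functor C D) : Prop :=
  left_adjoint F G.

Definition mutually_inverse (C D : category) (F : functor C D) (G : functor D C) : Prop :=
  functor_comp G F = functor_id C /\ functor_comp F G = functor_id D.

Section FullSubcategory.
Variables (C : category) (P : C -> Prop).

Definition full_sub : category :=
  @Category {a : C | P a} (fun a b => hom (sval a) (sval b))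
    (fun a => cid (sval a)) (fun _ _ _ g f => ccomp g f)
    (fun _ _ _ _ h g f => ccompA h g f)
    (fun _ _ f => ccomp1l f) (fun _ _ f => ccomp1r f).

Definition full_incl : functor full_sub C :=
  @Functor full_sub C sval (fun _ _ f => f) (fun=> erefl) (fun _ _ _ _ _ => erefl).

End FullSubcategory.

Record hom_class (C : category) := HomClass {
  in_class :> forall a b : C, hom a b -> Prop;
  in_class1 : forall a : C, in_class (cid a);
  in_classM : forall (a b c : C) (g : hom b c) (f : hom a b),
    in_class g -> in_class f -> in_class (ccomp g f)
}.
Arguments in_class {C} W {a b} f : rename.

(* The morphisms of a full subcategory which belong to a class of morphisms of
   the ambient category. *)
Definition full_class (C : category) (P : C -> Prop) (W : hom_class C) :
    hom_class (full_sub P) :=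
  @HomClass (full_sub P) (fun a b f => in_class W f)
    (fun a => in_class1 W (sval a)) (fun _ _ _ _ _ => @in_classM C W _ _ _ _ _).

Section WideSubcategory.
Variables (C : category) (W : hom_class C).

Definition wide_hom (a b : C) := {f : hom a b | in_class W f}.

Lemma wide_hom_inj a b (f g : wide_hom a b) : sval f = sval g -> f = g.
Proof.
case: f g => [f Wf] [g Wg] /= fg; case: _ / fg Wg => Wg.
by congr exist; exact: Prop_irrelevance.
Qed.

Definition wide_id a : wide_hom a a := exist _ (cid a) (in_class1 W a).

Definition wide_comp a b c (g : wide_hom b c) (f : wide_hom a b) : wide_hom a c :=
  exist _ (ccomp (sval g) (sval f)) (in_classM (svalP g) (svalP f)).

Lemma wide_compA a b c d (h : wide_hom c d) (g : wide_hom b c) (f : wide_hom a b) :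
  wide_comp h (wide_comp g f) = wide_comp (wide_comp h g) f.
Proof. by apply: wide_hom_inj; exact: ccompA. Qed.

Lemma wide_comp1l a b (f : wide_hom a b) : wide_comp (wide_id b) f = f.
Proof. by apply: wide_hom_inj; exact: ccomp1l. Qed.

Lemma wide_comp1r a b (f : wide_hom a b) : wide_comp f (wide_id a) = f.
Proof. by apply: wide_hom_inj; exact: ccomp1r. Qed.

Definition wide_sub : category :=
  @Category C wide_hom wide_id wide_comp wide_compA wide_comp1l wide_comp1r.

End WideSubcategory.

Section WideRestriction.
Variables (C D : category) (V : hom_class C) (W : hom_class D) (F : functor C D).
Hypothesis FVW : forall (a b : C) (f : hom a b), in_class V f -> in_class W (fmap F f).

Definition wide_fmap (a b : wide_sub V) (f : hom a b) :
    @hom (wide_sub W) (F a) (F b) :=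
  exist _ (fmap F (sval f)) (FVW (svalP f)).

Lemma wide_fmap1 a : wide_fmap (cid a) = cid _.
Proof. by apply: wide_hom_inj; exact: fmap1. Qed.

Lemma wide_fmapM a b c (g : hom b c) (f : hom a b) :
  @wide_fmap a c (ccomp g f) = ccomp (wide_fmap g) (wide_fmap f).
Proof. by apply: wide_hom_inj; exact: fmapM. Qed.

Definition wide_functor : functor (wide_sub V) (wide_sub W) :=
  @Functor (wide_sub V) (wide_sub W) F wide_fmap wide_fmap1 wide_fmapM.

End WideRestriction.

Section ActionCategory.
Variable S : restrictionSemigroupType.

Section ActionConditions.
Variables (X : semilatticeType) (p : {multiplicative X -> proj S}) (alpha : S -> pbij X).

Definition order_iso_on (f : pbij X) : Prop :=
  forall x y x' y', f x x' -> f y y' -> (sle x y <-> sle x' y').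

Definition top_dom (s : S) : set X :=
  dom (alpha s) `&` p @^-1` [set proj_star s].

Record is_action : Prop := IsAction {
  act_pre : premorphism alpha;
  act_A1 : forall s, order_ideal (dom (alpha s)) /\ order_ideal (ran (alpha s));
  act_A2 : forall s, order_iso_on (alpha s);
  act_A3 : forall e : proj S,
    downset (p @^-1` [set e]) `<=` dom (alpha e) /\
    dom (alpha e) `<=` p @^-1` (downset [set e]);
  act_A4 : forall s, top_dom s !=set0
}.

End ActionConditions.

Record action : Type := Action {
  act_car : semilatticeType;
  act_proj : {multiplicative act_car -> proj S};
  act_map :> S -> pbij act_car;
  actP : is_action act_proj act_map
}.

(* The second half of [ah_M2] is written on graphs: if [a s x = y], then
   [b s (f x) = f y]. *)
Record action_hom (a b : action) : Type := ActionHom {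
  ah_fun :> {multiplicative act_car a -> act_car b};
  ah_M1 : forall x, act_proj a x = act_proj b (ah_fun x);
  ah_M2 : forall s,
    ah_fun @` dom (a s) `<=` dom (b s) /\
    (forall x y, a s x y -> b s (ah_fun x) (ah_fun y))
}.

Lemma multiplicative_ext (X Y : magmaType) (f g : {multiplicative X -> Y}) :
  f =1 g -> f = g.
Proof.
case: f g => [f [[fM]]] [g [[gM]]] /= /funext fg.
by case: _ / fg gM => gM; do 3 f_equal; exact: Prop_irrelevance.
Qed.

Lemma action_hom_ext (a b : action) (f g : action_hom a b) : f =1 g -> f = g.
Proof.
case: f g => [f f1 f2] [g g1 g2] /= /multiplicative_ext fg.
by case: _ / fg g1 g2 => *; congr ActionHom; exact: Prop_irrelevance.
Qed.

Section IdComp.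
Variables a b c : action.

Lemma action_id_M2 s :
  [the {multiplicative _ -> _} of idfun] @` dom (a s) `<=` dom (a s) /\
  (forall x y, a s x y -> a s (idfun x) (idfun y)).
Proof. by split=> // _ [x dx <-]. Qed.

Definition action_id : action_hom a a :=
  @ActionHom a a [the {multiplicative _ -> _} of idfun] (fun=> erefl) action_id_M2.

Variables (g : action_hom b c) (f : action_hom a b).

Lemma action_comp_M1 x : act_proj a x = act_proj c ((g \o f) x).
Proof. by rewrite (ah_M1 f) (ah_M1 g). Qed.

Lemma action_comp_M2 s :
  (g \o f) @` dom (a s) `<=` dom (c s) /\
  (forall x y, a s x y -> c s ((g \o f) x) ((g \o f) y)).
Proof.
split=> [_ [x [y xy] <-] | x y xy].
- by exists (g (f y)); apply: (ah_M2 g s).2; exact: (ah_M2 f s).2.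
- by apply: (ah_M2 g s).2; exact: (ah_M2 f s).2.
Qed.

Definition action_comp : action_hom a c :=
  @ActionHom a c [the {multiplicative _ -> _} of g \o f] action_comp_M1 action_comp_M2.

End IdComp.

Lemma action_compA a b c d (h : action_hom c d) (g : action_hom b c) (f : action_hom a b) :
  action_comp h (action_comp g f) = action_comp (action_comp h g) f.
Proof. exact: action_hom_ext. Qed.

Lemma action_comp1l a b (f : action_hom a b) : action_comp (action_id b) f = f.
Proof. exact: action_hom_ext. Qed.

Lemma action_comp1r a b (f : action_hom a b) : action_comp f (action_id a) = f.
Proof. exact: action_hom_ext. Qed.

Definition cat_A : category :=
  @Category action action_hom action_id action_comp
    action_compA action_comp1l action_comp1r.

Definition A3a (a : action) : Prop := forall s,
  dom (a s) = [set y | exists2 t, rle t s & top_dom (act_proj a) a t y].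

Definition A3b (a : action) : Prop := forall s,
  dom (a s) = downset (top_dom (act_proj a) a s).

Definition cat_Ahat : category := @full_sub cat_A A3a.
Definition cat_Atilde : category := @full_sub cat_A A3b.

Definition M3 (a b : action) (f : action_hom a b) : Prop := forall s,
  top_dom (act_proj b) b s = f @` top_dom (act_proj a) a s.

Lemma M3_id a : M3 (action_id a).
Proof. by move=> s; rewrite image_id. Qed.

Lemma M3_comp a b c (g : action_hom b c) (f : action_hom a b) :
  M3 g -> M3 f -> M3 (action_comp g f).
Proof. by move=> gM fM s; rewrite gM fM image_comp. Qed.

Definition class_M3 : hom_class cat_A := @HomClass cat_A M3 M3_id M3_comp.
Definition class_M3hat : hom_class cat_Ahat := @full_class cat_A A3a class_M3.
Definition class_M3tilde : hom_class cat_Atilde := @full_class cat_A A3b class_M3.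

Definition cat_As : category := wide_sub class_M3.
Definition cat_Ahats : category := wide_sub class_M3hat.
Definition cat_Atildes : category := wide_sub class_M3tilde.

Definition Ihats : functor cat_Ahats cat_As :=
  @wide_functor _ _ class_M3hat class_M3 (@full_incl cat_A A3a) (fun _ _ _ h => h).
Definition Itildes : functor cat_Atildes cat_As :=
  @wide_functor _ _ class_M3tilde class_M3 (@full_incl cat_A A3b) (fun _ _ _ h => h).

Section ActionTheory.
Variable a : action.
Local Notation p := (act_proj a).

Let aP : premorphism a := act_pre (actP a).

Lemma act_dom_ideal s x y y' : a s y y' -> sle x y -> exists x', a s x x'.
Proof. by move=> yy' xy; apply: (act_A1 (actP a) s).1 xy; exists y'. Qed.

Lemma act_ran_ideal s x' y y' : a s y y' -> sle x' y' -> exists x, a s x x'.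
Proof. by move=> yy' xy; apply: (act_A1 (actP a) s).2 xy; exists y. Qed.

Lemma act_mono s x x' y y' : a s x x' -> a s y y' -> sle x y -> sle x' y'.
Proof. by move=> xx yy; move/(act_A2 (actP a) xx yy). Qed.

Lemma act_mono' s x x' y y' : a s x x' -> a s y y' -> sle x' y' -> sle x y.
Proof. by move=> xx yy; move/(act_A2 (actP a) xx yy). Qed.

Lemma act_proj_id (e : proj S) x y : a e x y -> x = y.
Proof.
move=> xy; have := pre_star aP xy; rewrite star_proj => xx.
exact: pbij_fun xx xy.
Qed.

Lemma act_proj_refl (e : proj S) x : p x = e -> a e x x.
Proof.
move=> pxe.
have [y xy] : dom (a e) x.
  by apply: (act_A3 (actP a) e).1; exists x => //; exact: sle_refl.
by have E := act_proj_id xy; subst y.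
Qed.

Lemma act_refl x : a (p x) x x.
Proof. exact: act_proj_refl. Qed.

Lemma act_proj_le (e : proj S) x y : a e x y -> sle (p x) e.
Proof.
move=> xy; have [|_ ->] // := (act_A3 (actP a) e).2 x.
by exists y.
Qed.

Lemma act_star_le s x y : a s x y -> sle (p x) (proj_star s).
Proof. by move=> /(pre_star aP); exact: (@act_proj_le (proj_star s)). Qed.

Lemma act_plus_le s x y : a s x y -> sle (p y) (proj_plus s).
Proof. by move=> /(pre_plus aP); exact: (@act_proj_le (proj_plus s)). Qed.

Lemma act_restr s x y : a s x y -> a (s * (p x : S)) x y.
Proof. move=> xy; exact (preM aP (act_refl x) xy). Qed.

Lemma act_restr_star s x y : a s x y -> proj_star (s * (p x : S)) = p x.
Proof.
move=> xy; have := act_star_le xy; rewrite /sle meetC => E.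
by apply: proj_inj; rewrite -[in RHS]E /= -[in LHS](star_proj (p x)) starMr star_proj.
Qed.

Lemma act_proj_ran s x y : a s x y -> p y = proj_plus (s * (p x : S)).
Proof.
move=> xy; set u := s * (p x : S); have xyu : a u x y by exact: act_restr.
apply: sle_anti; first exact: act_plus_le xyu.
have xyq : a ((p y : S) * u) x y by exact (preM aP xyu (act_refl y)).
have qu : rle ((p y : S) * u) u by exists (p y).
have E : (p y : S) * u = u.
  apply: (rle_star_eq qu); apply: sle_anti; first exact: sle_star.
  by rewrite (act_restr_star xy); exact: act_star_le xyq.
have : plus ((p y : S) * u) = plus u by rewrite E.
rewrite -[X in plus (X * _)]plus_proj plusMl plus_proj => Eu.
by rewrite /sle meetC; apply: proj_inj.
Qed.

Lemma act_top_ran s x y : a s x y -> p x = proj_star s -> p y = proj_plus s.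
Proof. by move=> xy px; rewrite (act_proj_ran xy) px; apply: proj_inj; rewrite /= star_mulr. Qed.

Lemma act_proj_dom s x y : a s x y -> p x = proj_star ((p y : S) * s).
Proof.
move=> xy; apply: sle_anti.
  by apply: (@act_star_le _ _ y); exact (preM aP xy (act_refl y)).
apply: proj_inj; rewrite proj_valM /= (act_proj_ran xy) /= plus_ample plus_proj.
by rewrite -[X in star (_ * X)]star_proj starMr star_proj -mulgAssoc -proj_valM meetI.
Qed.

Definition hat_graph s x y : Prop := exists2 t, rle t s & a t x y.

Lemma hat_fun s x y y' : hat_graph s x y -> hat_graph s x y' -> y = y'.
Proof. by move=> [t ts xy] [u us xy']; exact: (pre_compat_fun aP ts us xy xy'). Qed.

Lemma hat_inj s x x' y : hat_graph s x y -> hat_graph s x' y -> x = x'.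
Proof. by move=> [t ts xy] [u us xy']; exact: (pre_compat_inj aP ts us xy xy'). Qed.

(* Graph of the common extension of the [a t], [t <= s]. *)
Definition hat_map s : pbij (act_car a) := PBij (@hat_fun s) (@hat_inj s).

Lemma hat_top s : top_dom p hat_map s = top_dom p a s.
Proof.
apply/seteqP; split=> x [[y xy] px]; split=> //; last first.
  by exists y, s => //; exact: rle_refl.
exists y; case: xy => t ts xy; suff <- : t = s by [].
apply: rle_star_eq => //; apply: sle_anti; first exact: sle_star.
by have := act_star_le xy; rewrite px.
Qed.

Lemma hat_is_action : is_action p hat_map.
Proof.
have le1 s x y : a s x y -> hat_map s x y by exists s => //; exact: rle_refl.
split.
- apply/premorphismP; split.
  + move=> s t x y z [t' tt' xy] [s' ss' yz].
    by exists (s' * t'); [exact: rle_mul | exact (preM aP xy yz)].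
  + move=> s x [y [t ts xy]].
    by exists (star t); [exact: rle_star2 | exact (pre_star aP xy)].
  + move=> s y [x [t ts xy]].
    by exists (plus t); [exact: rle_plus2 | exact (pre_plus aP xy)].
- move=> s; split=> x y.
  + by move=> [z [t ts yz]] /(act_dom_ideal yz)[w xw]; exists w, t.
  + by move=> [z [t ts yz]] /(act_ran_ideal yz)[w xw]; exists w, t.
- move=> s x y x' y' xx' yy'; split=> le.
  + case: yy' => t ts yy'; have [z xz] := act_dom_ideal yy' le.
    have -> : x' = z by apply: hat_fun xx' _; exists t.
    exact: act_mono xz yy' le.
  + case: yy' => t ts yy'; have [z xz] := act_ran_ideal yy' le.
    have -> : x = z by apply: hat_inj xx' _; exists t.
    exact: act_mono' xz yy' le.
- move=> e; split=> x.
  + by move=> /(act_A3 (actP a) e).1 [y xy]; exists y; exact: le1.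
  + move=> [y [t /rle_proj[f -> fe] xy]]; exists e => //.
    exact: sle_trans (act_proj_le xy) fe.
- by move=> s; rewrite hat_top; exact: (act_A4 (actP a)).
Qed.

Definition hat_action : action := Action hat_is_action.

Lemma hat_A3a : A3a hat_action.
Proof.
move=> s; apply/seteqP; split=> x.
- move=> [y [t ts xy]]; exists (t * (p x : S)).
    by apply: rle_trans ts; exact: rle_mulr.
  split; last by rewrite /= (act_restr_star xy).
  by exists y, (t * (p x : S)); [exact: rle_refl | exact: act_restr].
- by move=> [t ts [[y [u ut xy]] _]]; exists y, u => //; exact: rle_trans ts.
Qed.

Definition tilde_graph s x y : Prop :=
  downset (top_dom p a s) x /\ a s x y.

Lemma tilde_fun s x y y' : tilde_graph s x y -> tilde_graph s x y' -> y = y'.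
Proof. by move=> [_ xy] [_ xy']; exact: pbij_fun xy xy'. Qed.

Lemma tilde_inj s x x' y : tilde_graph s x y -> tilde_graph s x' y -> x = x'.
Proof. by move=> [_ xy] [_ xy']; exact: pbij_inj xy xy'. Qed.

Definition tilde_map s : pbij (act_car a) := PBij (@tilde_fun s) (@tilde_inj s).

Lemma tilde_top s : top_dom p tilde_map s = top_dom p a s.
Proof.
apply/seteqP; split=> x [[y xy] px]; split=> //; exists y; first exact: xy.2.
by split=> //; exists x; [split => //; exists y | exact: sle_refl].
Qed.

Lemma tilde_is_action : is_action p tilde_map.
Proof.
split.
- apply/premorphismP; split.
  + move=> s t x y z [[x1 [[y1 xy1] px1] xx1] xy] [[y2 [[z2 yz2] py2] yy2] yz].
    split; last exact (preM aP xy yz).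
    have yy1 := act_mono xy xy1 xx1.
    have [x2 xy2] : exists x2, a t x2 (y2 * y1).
      by apply: act_ran_ideal xy1 _; exact: sle_meetr.
    have [z3 yz3] : exists z3, a s (y2 * y1) z3.
      by apply: act_dom_ideal yz2 _; exact: sle_meetl.
    exists x2; last by apply: act_mono' xy xy2 _; exact: sle_meet.
    split; first by exists z3; exact (preM aP xy2 yz3).
    rewrite /= (act_proj_dom xy2) gmulfM py2 (act_top_ran xy1 px1).
    apply: proj_inj; rewrite /= -mulgAssoc plus_mull; exact: star_mul_star.
  + move=> s x [y [[x1 [[y1 xy1] px1] xx1] xy]]; split; last exact (pre_star aP xy).
    exists x1 => //; split; first by exists x1; exact (pre_star aP xy1).
    by rewrite /= px1; apply: proj_inj; rewrite /= starst.
  + move=> s y [x [[x1 [[y1 xy1] px1] xx1] xy]]; split; last exact (pre_plus aP xy).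
    exists y1; last exact: act_mono xy xy1 xx1.
    split; first by exists y1; exact (pre_plus aP xy1).
    by rewrite /= (act_top_ran xy1 px1); apply: proj_inj; rewrite /= plusK.
- move=> s; split=> x y.
  + move=> [z [dy yz]] xy; have [w xw] := act_dom_ideal yz xy.
    by exists w; split => //; exact: downset_ideal xy.
  + move=> [z [dy yz]] xy; have [w xw] := act_ran_ideal yz xy.
    by exists w; split => //; apply: downset_ideal dy _; exact: act_mono' xw yz xy.
- by move=> s x y x' y' [_ xx'] [_ yy']; exact: (act_A2 (actP a)) xx' yy'.
- move=> e; split=> x.
  + move=> de; have [x1 px1 xx1] := de.
    have [y xy] := (act_A3 (actP a) e).1 _ de.
    exists y; split => //; exists x1 => //; split.
      by exists x1; exact: act_proj_refl.
    by rewrite /= px1 proj_starE.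
  + by move=> [y [_ xy]]; exists e => //; exact: act_proj_le xy.
- by move=> s; rewrite tilde_top; exact: (act_A4 (actP a)).
Qed.

Definition tilde_action : action := Action tilde_is_action.

Lemma tilde_A3b : A3b tilde_action.
Proof.
move=> s; rewrite [X in downset X]tilde_top; apply/seteqP; split=> x.
- by move=> [y [dx _]].
- move=> dx; have [x1 [[y1 xy1] _] xx1] := dx.
  by have [y xy] := act_dom_ideal xy1 xx1; exists y.
Qed.

End ActionTheory.

Section FunctorMaps.
Variables (a b : action) (f : action_hom a b).

Lemma hat_M2 s :
  f @` dom (hat_action a s) `<=` dom (hat_action b s) /\
  (forall x y, hat_action a s x y -> hat_action b s (f x) (f y)).
Proof.
have H x y : hat_action a s x y -> hat_action b s (f x) (f y).
  by move=> [t ts xy]; exists t => //; exact: (ah_M2 f t).2.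
by split=> // _ [x [y xy] <-]; exists (f y); exact: H.
Qed.

Definition hat_hom : action_hom (hat_action a) (hat_action b) :=
  @ActionHom (hat_action a) (hat_action b) f (ah_M1 f) hat_M2.

Lemma hat_M3 : M3 f -> M3 hat_hom.
Proof.
move=> fM s; apply: etrans (hat_top b s) (etrans (fM s) _).
exact: (congr1 (fun A => f @` A) (esym (hat_top a s))).
Qed.

Lemma tilde_M2 s :
  f @` dom (tilde_action a s) `<=` dom (tilde_action b s) /\
  (forall x y, tilde_action a s x y -> tilde_action b s (f x) (f y)).
Proof.
have H x y : tilde_action a s x y -> tilde_action b s (f x) (f y).
  move=> [[x1 [[y1 xy1] px1] xx1] xy]; split; last exact: (ah_M2 f s).2.
  exists (f x1); last exact: sle_morph.
  by split; [exists (f y1); exact: (ah_M2 f s).2 | rewrite /= -ah_M1].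
by split=> // _ [x [y xy] <-]; exists (f y); exact: H.
Qed.

Definition tilde_hom : action_hom (tilde_action a) (tilde_action b) :=
  @ActionHom (tilde_action a) (tilde_action b) f (ah_M1 f) tilde_M2.

Lemma tilde_M3 : M3 f -> M3 tilde_hom.
Proof.
move=> fM s; apply: etrans (tilde_top b s) (etrans (fM s) _).
exact: (congr1 (fun A => f @` A) (esym (tilde_top a s))).
Qed.

End FunctorMaps.

Lemma hat_hom_id a : hat_hom (action_id a) = action_id (hat_action a).
Proof. exact: action_hom_ext. Qed.

Lemma hat_hom_comp a b c (g : action_hom b c) (f : action_hom a b) :
  hat_hom (action_comp g f) = action_comp (hat_hom g) (hat_hom f).
Proof. exact: action_hom_ext. Qed.

Definition Fhat : functor cat_A cat_Ahat :=
  @Functor cat_A cat_Ahat (fun a => exist _ (hat_action a) (@hat_A3a a))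
    hat_hom hat_hom_id hat_hom_comp.

Lemma tilde_hom_id a : tilde_hom (action_id a) = action_id (tilde_action a).
Proof. exact: action_hom_ext. Qed.

Lemma tilde_hom_comp a b c (g : action_hom b c) (f : action_hom a b) :
  tilde_hom (action_comp g f) = action_comp (tilde_hom g) (tilde_hom f).
Proof. exact: action_hom_ext. Qed.

Definition Ftilde : functor cat_A cat_Atilde :=
  @Functor cat_A cat_Atilde (fun a => exist _ (tilde_action a) (@tilde_A3b a))
    tilde_hom tilde_hom_id tilde_hom_comp.

Definition Fhats : functor cat_As cat_Ahats :=
  @wide_functor _ _ class_M3 class_M3hat Fhat hat_M3.

Definition Ftildes : functor cat_As cat_Atildes :=
  @wide_functor _ _ class_M3 class_M3tilde Ftilde tilde_M3.

End ActionCategory.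

(* Main.v *)
Require Import Defs.
From HB Require Import structures.
From mathcomp Require Import all_boot.
From mathcomp Require Import boolp classical_sets.

(** The functors [Fhats] and [Ftildes] change neither the semilattice of an
    object nor its map to the projections, and by [hat_top] and [tilde_top] they
    preserve the sets [top_dom s], in terms of which (M3) is stated.  They only
    enlarge (hat) or shrink (tilde) the partial bijections, so the identity of
    the carrier is always a morphism [a -> hat a] and [tilde a -> a], and it
    satisfies (M3).

    If [b] satisfies (A3a), then every [b t] with [t] below [s] is contained in
    [b s] ([A3a_mono]); hence the identity is also a morphism [hat b -> b].  If
    [c] satisfies (A3b), every point where [c s] is defined lies below a point of
    [top_dom s], so the identity is a morphism [c -> tilde c].  These four
    morphisms are the units and counits of the two adjunctions; naturality and
    the triangle identities hold because all the underlying maps are identities.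

    For the isomorphism of categories, both conditions say that the action is
    determined by its restrictions to the sets [top_dom s]: an (A3a) action is
    recovered from them by gluing along the order of [S] ([hat_tilde_id]), an
    (A3b) action by closing domains downwards ([tilde_hat_id]).  So the composite
    functors fix every object on the nose.  They equal the identity functors
    because, moreover, transport along these equalities of objects is the
    identity on carriers ([action_eq_id]), and morphisms keep their underlying
    maps. *)

Set Implicit Arguments.
Unset Strict Implicit.
Unset Printing Implicit Defensive.

Local Open Scope classical_set_scope.

Section CategoryTheory.

(** The transpose of [h] is [fmap G h] after the unit, that of [k] is the counit
    after [fmap F k]; naturality and the triangle identities make them inverse. *)
Lemma left_adjoint_unit_counit (C D : category) (F : functor C D) (G : functor D C)
    (eta : forall c, hom c (G (F c))) (eps : forall d, hom (F (G d)) d) :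
  (forall c c' (f : hom c c'), ccomp (eta c') f = ccomp (fmap G (fmap F f)) (eta c)) ->
  (forall d d' (g : hom d d'), ccomp g (eps d) = ccomp (eps d') (fmap F (fmap G g))) ->
  (forall c, ccomp (eps (F c)) (fmap F (eta c)) = Defs.cid (F c)) ->
  (forall d, ccomp (fmap G (eps d)) (eta (G d)) = Defs.cid (G d)) ->
  left_adjoint F G.
Proof.
move=> etaN epsN triF triG.
exists (fun c d h => ccomp (fmap G h) (eta c)); split=> [c d|c c' d d' f g h].
  exists (fun k => ccomp (eps d) (fmap F k)) => [h|k].
    by rewrite fmapM ccompA -epsN -ccompA triF ccomp1r.
  by rewrite fmapM -ccompA -etaN ccompA triG ccomp1l.
by rewrite !fmapM -!ccompA etaN.
Qed.

Definition hom_of_eq (C : category) (a b : C) (e : a = b) : hom a b :=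
  eq_rect a (hom a) (Defs.cid a) b e.

(** Agreement on morphisms is expressed as naturality of the family
    [hom_of_eq (E a)] rather than by casting hom-types along [E]: composition
    with [hom_of_eq] can be computed on underlying maps. *)
Lemma functor_eq_id (C : category) (F : functor C C) (E : forall a, F a = a) :
  (forall (a b : C) (f : hom a b),
     ccomp (hom_of_eq (E b)) (fmap F f) = ccomp f (hom_of_eq (E a))) ->
  F = functor_id C.
Proof.
case: F E => Fo Fm F1 FM /= E.
have Fo_id : Fo = id by exact/funext.
subst Fo => N.
have Fm_id : Fm = fun _ _ f => f.
  apply: functional_extensionality_dep => a; apply: functional_extensionality_dep => b.
  apply/funext => f; have := N a b f.
  rewrite (Prop_irrelevance (E a) erefl) (Prop_irrelevance (E b) erefl) /=.
  by rewrite ccomp1l ccomp1r.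
subst Fm; rewrite /functor_id.
by congr Functor; exact: Prop_irrelevance.
Qed.

Lemma hom_of_eq_wide_full (C : category) (P : C -> Prop) (W : hom_class C)
    (u v : wide_sub (full_class P W)) (e : u = v) (e' : sval u = sval v) :
  sval (hom_of_eq e) = hom_of_eq e'.
Proof. by case: _ / e e' => e'; rewrite (Prop_irrelevance e' erefl). Qed.

(** Membership in the full and wide subcategories is proof-irrelevant, so both
    the equalities of objects and their naturality can be given in the ambient
    category. *)
Lemma functor_eq_id_wide_full (C : category) (P : C -> Prop) (W : hom_class C)
    (F : functor (wide_sub (full_class P W)) (wide_sub (full_class P W)))
    (E : forall u, sval (F u) = sval u) :
  (forall (u v : wide_sub (full_class P W)) (f : hom u v),
     ccomp (hom_of_eq (E v)) (sval (fmap F f)) = ccomp (sval f) (hom_of_eq (E u))) ->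
  F = functor_id _.
Proof.
move=> N.
have E' u : F u = u.
  by case: (F u) (E u) => [c Pc] /=; case: u => [d Pd] /= cd; exact: eq_exist.
apply: (functor_eq_id (E := E')) => u v f; apply: wide_hom_inj.
rewrite [LHS]/= [RHS]/= (hom_of_eq_wide_full (E' u) (E u)).
by rewrite (hom_of_eq_wide_full (E' v) (E v)); exact: N.
Qed.

End CategoryTheory.

Section Actions.
Variable S : restrictionSemigroupType.
Implicit Types a b : action S.

Lemma le_hat a s x y : a s x y -> hat_map a s x y.
Proof. by exists s => //; exact: rle_refl. Qed.

Lemma tilde_le a s x y : tilde_map a s x y -> a s x y.
Proof. by case. Qed.

Section CarrierIdentity.
Variables (a : action S) (m : S -> pbij (act_car a)).
Hypothesis mP : is_action (act_proj a) m.

Section To.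
Hypothesis le_m : forall s x y, a s x y -> m s x y.

Lemma id_to_M2 s :
  [the {multiplicative _ -> _} of idfun] @` dom (a s) `<=` dom (m s) /\
  (forall x y, a s x y -> m s (idfun x) (idfun y)).
Proof. by split=> [_ [x [y xy] <-]|x y]; [exists y; exact: le_m | exact: le_m]. Qed.

Definition id_to : action_hom a (Action mP) :=
  @ActionHom S a (Action mP) [the {multiplicative _ -> _} of idfun] (fun=> erefl) id_to_M2.

Lemma id_to_M3 :
  (forall s, top_dom (act_proj a) m s = top_dom (act_proj a) a s) -> M3 id_to.
Proof. by move=> mE s; rewrite image_id; exact: mE. Qed.

End To.

Section From.
Hypothesis ge_m : forall s x y, m s x y -> a s x y.

Lemma id_from_M2 s :
  [the {multiplicative _ -> _} of idfun] @` dom (m s) `<=` dom (a s) /\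
  (forall x y, m s x y -> a s (idfun x) (idfun y)).
Proof. by split=> [_ [x [y xy] <-]|x y]; [exists y; exact: ge_m | exact: ge_m]. Qed.

Definition id_from : action_hom (Action mP) a :=
  @ActionHom S (Action mP) a [the {multiplicative _ -> _} of idfun] (fun=> erefl) id_from_M2.

Lemma id_from_M3 :
  (forall s, top_dom (act_proj a) m s = top_dom (act_proj a) a s) -> M3 id_from.
Proof. by move=> mE s; rewrite image_id; apply/esym/mE. Qed.

End From.

(** [hom_of_eq] does not compute on an opaque equality, so what its transport
    does to points has to be recorded along with the equality itself. *)
Lemma action_eq_id :
  (forall s x y, m s x y <-> a s x y) ->
  exists e : Action mP = a :> cat_A S, forall x, hom_of_eq e x = x.
Proof.
case: a m mP => X p m' m'P n nP /= nE.
have {nE} ?: n = m' by apply/funext => s; apply: pbij_ext => x y; exact: nE.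
subst n; rewrite (Prop_irrelevance nP m'P).
by exists erefl.
Qed.

End CarrierIdentity.

Section ConditionA3a.
Variable b : action S.
Hypothesis bA : A3a b.

(** (A3a) gives [dom (b t) `<=` dom (b s)]; the values agree because those of a
    premorphism at elements below a common bound are compatible. *)
Lemma A3a_mono s t x y : rle t s -> b t x y -> b s x y.
Proof.
move=> ts xy; have : dom (b s) x.
  have : dom (b t) x by exists y.
  by rewrite !bA => -[u ut ux]; exists u => //; exact: rle_trans ts.
case=> z xz; suff <- : z = y by [].
exact: (pre_compat_fun (act_pre (actP b)) (rle_refl s) ts xz xy).
Qed.

Lemma hat_le_A3a s x y : hat_map b s x y -> b s x y.
Proof. by move=> [t ts]; exact: A3a_mono. Qed.

(** By (A3a) each point of [dom (b s)] is a top point of some [b t] below [b s];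
    the tilde keeps top points, and the hat brings [b t] back into [b s]. *)
Lemma hat_tilde_id s x y : hat_map (tilde_action b) s x y <-> b s x y.
Proof.
split=> [[t ts [_ xy]]|xy]; first exact: A3a_mono xy.
have : dom (b s) x by exists y.
rewrite bA => -[t ts tx]; have [[z xz] _] := tx.
(* [x] is its own witness for the downset, as it lies in [top_dom t]. *)
exists t => //; split; first by exists x => //; exact: sle_refl.
by rewrite (pbij_fun xy (A3a_mono ts xz)).
Qed.

End ConditionA3a.

Section ConditionA3b.
Variable a : action S.
Hypothesis aA : A3b a.

Lemma A3b_le_tilde s x y : a s x y -> tilde_map a s x y.
Proof. by move=> xy; split=> //; rewrite -aA; exists y. Qed.

Lemma tilde_hat_id s x y : tilde_map (hat_action a) s x y <-> a s x y.
Proof.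
split=> [[dx xy]|xy].
  (* The hat does not change the top domain, so by (A3b) [a s] is defined at [x]. *)
  have : dom (a s) x by rewrite aA -[top_dom _ _ _]hat_top.
  by case=> z xz; rewrite (pbij_fun xy (le_hat xz)).
split; last exact: le_hat.
rewrite [X in downset X](hat_top a s) -aA.
by exists y.
Qed.

End ConditionA3b.

Lemma Fhats_left_adjoint : left_adjoint (Fhats S) (Ihats S).
Proof.
pose eta (a : cat_As S) : hom a (Ihats S (Fhats S a)) :=
  exist _ (id_to (hat_is_action a) (@le_hat a))
    (id_to_M3 (hat_is_action a) (@le_hat a) (hat_top a)).
pose eps (b : cat_Ahats S) : hom (Fhats S (Ihats S b)) b :=
  exist _ (id_from (hat_is_action (sval b)) (hat_le_A3a (svalP b)))
    (id_from_M3 (hat_is_action (sval b)) (hat_le_A3a (svalP b)) (hat_top (sval b))).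
by apply: (left_adjoint_unit_counit (eta := eta) (eps := eps)) => *;
  apply: wide_hom_inj; exact: action_hom_ext.
Qed.

Lemma Ftildes_right_adjoint : right_adjoint (Ftildes S) (Itildes S).
Proof.
pose eta (c : cat_Atildes S) : hom c (Ftildes S (Itildes S c)) :=
  exist _ (id_to (tilde_is_action (sval c)) (A3b_le_tilde (svalP c)))
    (id_to_M3 (tilde_is_action (sval c)) (A3b_le_tilde (svalP c)) (tilde_top (sval c))).
pose eps (d : cat_As S) : hom (Itildes S (Ftildes S d)) d :=
  exist _ (id_from (tilde_is_action d) (@tilde_le d))
    (id_from_M3 (tilde_is_action d) (@tilde_le d) (tilde_top d)).
by apply: (left_adjoint_unit_counit (eta := eta) (eps := eps)) => *;
  apply: wide_hom_inj; exact: action_hom_ext.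
Qed.

End Actions.

Theorem corollary6p5 (S : restrictionSemigroupType) :
  [/\ left_adjoint (Fhats S) (Ihats S),
      right_adjoint (Ftildes S) (Itildes S) &
      mutually_inverse (functor_comp (Ftildes S) (Ihats S))
                       (functor_comp (Fhats S) (Itildes S))].
Proof.
split; [exact: Fhats_left_adjoint | exact: Ftildes_right_adjoint | split].
- pose e (u : cat_Ahats S) := boolp.cid (action_eq_id (a := sval u)
    (hat_is_action (tilde_action (sval u))) (hat_tilde_id (svalP u))).
  pose H := functor_comp (functor_comp (Fhats S) (Itildes S))
                         (functor_comp (Ftildes S) (Ihats S)).
  apply: (functor_eq_id_wide_full (F := H) (E := fun u => sval (e u))) => u v f.
  by apply: action_hom_ext => x /=; rewrite (svalP (e u)) (svalP (e v)).
- pose e (u : cat_Atildes S) := boolp.cid (action_eq_id (a := sval u)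
    (tilde_is_action (hat_action (sval u))) (tilde_hat_id (svalP u))).
  pose H := functor_comp (functor_comp (Ftildes S) (Ihats S))
                         (functor_comp (Fhats S) (Itildes S)).
  apply: (functor_eq_id_wide_full (F := H) (E := fun u => sval (e u))) => u v f.
  by apply: action_hom_ext => x /=; rewrite (svalP (e u)) (svalP (e v)).
Qed.
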